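(* There is a family $\mathcal{P}$ of cardinality $\mathfrak{c} = |\mathbb{R}|$ of pairwise non-homeomorphic Peano continua such that $X \times X$ is homeomorphic to $X$ for each $X \in \mathcal{P}$.
   Context: A continuum is a (nonempty) compact connected metrizable topological space. A Peano continuum is a locally connected continuum. *)

(* Defs.v *)
From mathcomp Require Import all_boot all_order all_algebra.
From mathcomp Require Import all_classical all_reals all_analysis.
Set Implicit Arguments.
Unset Strict Implicit.
Unset Printing Implicit Defensive.
Local Open Scope classical_set_scope.

Definition homeomorphic (X Y : topologicalType) : Prop :=
  exists (f : X -> Y) (g : Y -> X),
    [/\ continuous f, continuous g, cancel f g & cancel g f].

(* [R] is only where the distances live. *)
Definition metrizable (R : realType) (X : topologicalType) : Prop :=
  exists M : metricType R, homeomorphic X M.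

Definition locally_connected (X : topologicalType) : Prop :=
  forall (x : X) (U : set X), nbhs x U ->
    exists V : set X, [/\ open V, connected V, V x & V `<=` U].

(* [connected] holds of the empty set, so nonemptiness is required apart. *)
Definition continuum (R : realType) (X : topologicalType) : Prop :=
  [/\ [set: X] !=set0, compact [set: X], connected [set: X] &
      metrizable R X].

Definition peano_continuum (R : realType) (X : topologicalType) : Prop :=
  continuum R X /\ locally_connected X.

(* Main.v *)
Require Import Defs.
From HB Require Import structures.
From mathcomp Require Import all_boot all_order all_algebra.
From mathcomp Require Import all_classical all_reals all_analysis.
From mathcomp Require Import ring lra zify.

(** For a prime [p >= 5] let [Z/p] act by cyclic shifts on the unit sphere (for
    the sup norm) of the hyperplane [sum_i v_i = 0] of [R^p].  The action is free
    and isometric, and the sphere is simply connected, so its orbit space [L_p]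
    is a Peano continuum with fundamental group [Z/p].  A product of countably
    many spaces [L_p], each prime being repeated infinitely often, is a Peano
    continuum homeomorphic to its square; it contains an essential loop whose
    [p]-th power is null-homotopic if and only if [p] is one of the primes used.
    The sets of integers [code r n = <n, floor (n r)>], for [r] real, provide
    continuum many pairwise distinct sets of primes.

    Neither fundamental groups nor general covering theory are needed: the
    homotopies in a product are chosen coordinatewise, and in [L_p] one only
    lifts paths and squares along the quotient map from the sphere. *)

Set Implicit Arguments.
Unset Strict Implicit.
Unset Printing Implicit Defensive.
Import Order.TTheory GRing.Theory Num.Theory.
Import numFieldNormedType.Exports.
Local Open Scope classical_set_scope.
Local Open Scope ring_scope.

(** * Continuity, clamping and uniform continuity *)

Lemma pair_continuous (T X Y : topologicalType) (f : T -> X) (g : T -> Y) :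
  continuous f -> continuous g -> continuous (fun t => (f t, g t)).
Proof. by move=> cf cg t; exact: (cvg_pair (cf t) (cg t)). Qed.

Lemma comp_continuous (T X Y : topologicalType) (f : T -> X) (g : X -> Y) :
  continuous f -> continuous g -> continuous (fun t => g (f t)).
Proof. by move=> cf cg t; exact: (continuous_comp (cf t) (cg _)). Qed.

Lemma id_continuous (T : topologicalType) : continuous (fun t : T => t).
Proof. by move=> t; exact: cvg_id. Qed.

Lemma fst_continuous (X Y : topologicalType) : continuous (@fst X Y).
Proof. by move=> u; exact: cvg_fst. Qed.

Lemma snd_continuous (X Y : topologicalType) : continuous (@snd X Y).
Proof. by move=> u; exact: cvg_snd. Qed.

Lemma lmul_continuous (R : realType) (c : R) : continuous (fun x : R => c * x).
Proof. by move=> x; apply: cvgM; [exact: cvg_cst|exact: cvg_id]. Qed.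

Section Clamp.
Context {R : realType}.
Implicit Types x y : R.

(** The retraction of the line onto [[0, 1]]; it turns data on the unit interval or square into
    total functions. *)
Definition clamp x : R := Num.max 0 (Num.min 1 x).

Lemma clamp_ge0 x : 0 <= clamp x.
Proof. by rewrite /clamp le_max lexx. Qed.

Lemma clamp_le1 x : clamp x <= 1.
Proof. by rewrite /clamp ge_max ler01 ge_min lexx. Qed.

Lemma clamp_id x : 0 <= x <= 1 -> clamp x = x.
Proof. by move=> /andP[x0 x1]; rewrite /clamp (min_idPr x1) (max_idPr x0). Qed.

Lemma clamp0 : clamp 0 = 0.
Proof. by rewrite clamp_id// lexx ler01. Qed.

Lemma clamp1 : clamp 1 = 1.
Proof. by rewrite clamp_id// lexx ler01. Qed.

Lemma clamp_le0 x : x <= 0 -> clamp x = 0.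
Proof.
move=> x0; rewrite /clamp (min_idPr _) ?(max_idPl x0)//.
by rewrite (le_trans x0) ?ler01.
Qed.

Lemma clamp_ge1 x : 1 <= x -> clamp x = 1.
Proof. by move=> x1; rewrite /clamp (min_idPl x1) (max_idPr ler01). Qed.

Lemma clamp_continuous : continuous clamp.
Proof.
move=> x; apply: (@continuous_max R R^o (fun=> 0) (fun x => Num.min 1 x)).
  exact: cvg_cst.
by apply: (@continuous_min R R^o (fun=> 1) id); [exact: cvg_cst|exact: cvg_id].
Qed.

End Clamp.

(** Heine-Cantor, where only [u] has to lie in [K]: compactness in its near-covering form yields one
    radius valid around all points of [K]. *)
Lemma compact_uniform (R : realType) (T M : pseudoMetricType R) (K : set T)
    (f : T -> M) (e : R) : compact K -> continuous f -> 0 < e ->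
  exists2 d : R, 0 < d & forall u u', K u -> ball u d u' -> ball (f u) e (f u').
Proof.
move=> /compact_near_coveringP cK cf e0.
have := cK R 0^'+ (fun d u => forall u', ball u d u' -> ball (f u) e (f u')) _.
move=> /(_ _)/=[].
  move=> x Kx.
  have /cf /nbhs_ballP[d /= d0 xd] : nbhs (f x) (ball (f x) (e / 2)).
    by apply: nbhsx_ballx; rewrite divr_gt0.
  near=> y d' => u' /= yu'.
  apply: (@ball_splitr _ _ (f x)); apply: xd.
    apply: (@le_ball _ _ _ (d / 2)); first by rewrite ler_pdivrMr// ler_pMr// ler1n.
    by near: y; apply: nbhsx_ballx; rewrite divr_gt0.
  rewrite (splitr d); apply: (@ball_triangle _ _ y).
    by near: y; apply: nbhsx_ballx; rewrite divr_gt0.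
  apply: le_ball yu'; near: d'; apply: nbhs_right_le; by rewrite divr_gt0.
move=> d /= d0 dK; exists (d / 2); first by rewrite divr_gt0.
move=> u u' Ku; apply: (dK (d / 2)) => //=; last by rewrite divr_gt0.
rewrite sub0r normrN gtr0_norm ?divr_gt0// ltr_pdivrMr// ltr_pMr// ltr1n.
Unshelve. all: by end_near. Qed.

(** * The sphere *)

Section Sphere.
Context {R : realType} {q : nat}.
Local Notation V := 'rV[R]_q.+4.
Implicit Types u v w : V.

Definition zsum v : R := \sum_i v ord0 i.

Definition sphere : set V := [set v | zsum v = 0 /\ `|v| = 1].

Lemma zsumD u v : zsum (u + v) = zsum u + zsum v.
Proof. by rewrite /zsum -big_split; apply: eq_bigr => i _; rewrite mxE. Qed.

Lemma zsumZ a v : zsum (a *: v) = a * zsum v.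
Proof. by rewrite /zsum mulr_sumr; apply: eq_bigr => i _; rewrite mxE. Qed.

Lemma zsum_continuous : continuous zsum.
Proof.
apply: continuous_big => [|i _]; first exact: add_continuous.
exact: coord_continuous.
Qed.

Lemma sphere_compact : compact sphere.
Proof.
apply: bounded_closed_compact.
  by exists 1; split => // M M1 v [_ v1] /=; rewrite v1 ltW.
have -> : sphere = zsum @^-1` [set 0] `&` Num.norm @^-1` [set 1] by [].
apply: closedI; apply: preimage_closed.
- by move=> v _; exact: zsum_continuous.
- exact: closed_eq.
- by move=> v _; exact: norm_continuous.
- exact: closed_eq.
Qed.

Definition normalize v : V := `|v|^-1 *: v.

Lemma normalize_sphere v : zsum v = 0 -> v != 0 -> sphere (normalize v).
Proof.
move=> v0 vn0; split; first by rewrite zsumZ v0 mulr0.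
by rewrite normrZ normfV normr_id mulVf// normr_eq0.
Qed.

Lemma normalize_id v : sphere v -> normalize v = v.
Proof. by case=> _ v1; rewrite /normalize v1 invr1 scale1r. Qed.

Lemma normalize_continuous (T : topologicalType) (f : T -> V) :
  continuous f -> (forall t, f t != 0) -> continuous (normalize \o f).
Proof.
move=> cf f0 t; apply: cvgZ; last exact: cf.
by apply: cvgV; [rewrite normr_eq0|apply: cvg_norm; exact: cf].
Qed.

(* A plane through the origin meets the curve [t |-> (1, t, t^2, ...)] at most
   twice. *)
Lemma avoid_planes (s : seq (V * V)) : exists2 v, zsum v = 0 &
  forall (w : V * V) (a b : R), w \in s -> v != a *: w.1 + b *: w.2.
Proof.
(* The fourth coordinate makes the sum vanish; the later ones are zero by the default of [nth]. *)
pose c (t : R) : V := \row_i nth 0 [:: 1; t; t ^+ 2; - (1 + t + t ^+ 2)] i.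
have c0 t : zsum (c t) = 0.
  rewrite /zsum; do 4 rewrite big_ord_recl; rewrite big1 ?mxE/=; first by ring.
  by move=> i _; rewrite mxE/= nth_default.
have plane (w : V * V) : exists2 P : {poly R}, P != 0 &
    forall t (a b : R), c t = a *: w.1 + b *: w.2 -> root P t.
  pose j (i : 'I_3) : 'I_q.+4 := widen_ord (isT : (3 <= q.+4)%N) i.
  pose M : 'M[R]_(3, 2) :=
    \matrix_(i, k) (if k == ord0 then w.1 else w.2) ord0 (j i).
  (* [M] has rank at most 2, so its three rows satisfy a relation [l]. As a polynomial of degree at
     most 2, [l] vanishes at [t] whenever [c t] lies in the plane. *)
  have /rowV0Pn[l /sub_kermxP lM l0] : kermx M != 0.
    rewrite -mxrank_eq0 mxrank_ker -lt0n subn_gt0.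
    by rewrite (leq_ltn_trans (rank_leq_col M)).
  exists (rVpoly l); first by apply: contra_neq l0 => Pl; rewrite -[l]rVpolyK Pl linear0.
  move=> t a b ct; rewrite /root.
  have -> : (rVpoly l).[t] = \sum_i l ord0 i * c t ord0 (j i).
    rewrite (@horner_coef_wide _ 3) ?size_poly//; apply: eq_bigr => i _.
    rewrite coef_rVpoly_ord mxE; case: i => [[|[|[|]]]] //= _; rewrite ?expr0 //.
  have wM (k : 'I_2) : \sum_i l ord0 i * (if k == ord0 then w.1 else w.2) ord0 (j i) = 0.
    move/matrixP/(_ ord0 k): lM; rewrite !mxE => {2}<-.
    by apply: eq_bigr => i _; rewrite mxE.
  apply/eqP; transitivity (a * \sum_i l ord0 i * w.1 ord0 (j i) +
      b * \sum_i l ord0 i * w.2 ord0 (j i)).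
    rewrite !mulr_sumr -big_split; apply: eq_bigr => i _; rewrite ct !mxE/=; ring.
  by rewrite (wM ord0) (wM ord_max) !mulr0 addr0.
have [P P0 Ps] : exists2 P : {poly R}, P != 0 &
    forall (w : V * V) t (a b : R), w \in s -> c t = a *: w.1 + b *: w.2 -> root P t.
  elim: s => [|w s [P P0 Ps]]; first by exists 1; rewrite ?oner_neq0.
  have [Q Q0 Qw] := plane w; exists (Q * P); first by rewrite mulf_neq0.
  move=> w' t a b; rewrite inE rootM => /orP[/eqP->|w's] ct.
    by rewrite (Qw _ _ _ ct).
  by rewrite (Ps _ _ _ _ w's ct) orbT.
(* The integers below [size P] are too many to be all roots of [P]. *)
have [t Pt] : exists t, ~~ root P t.
  apply: contrapT => /forallNP Proot.
  have := @max_poly_roots _ P [seq i%:R | i <- iota 0 (size P)] P0.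
  rewrite size_map size_iota ltnn => H; apply: notF; apply: H.
    by apply/allP => t _; exact/negPn/negP/Proot.
  by rewrite map_inj_uniq ?iota_uniq// => a b /eqP; rewrite eqr_nat => /eqP.
exists (c t) => // w a b ws; apply: contra Pt => /eqP; exact: Ps ws.
Qed.

End Sphere.

(** * Broken lines in a normed space *)

Lemma clamp_affine_continuous (R : realType) (a b : R) :
  continuous (fun x : R => clamp (a * x + b)).
Proof.
move=> x; apply: (@continuous_comp _ _ _ (fun x => a * x + b) clamp).
  by apply: cvgD; [apply: cvgM; [exact: cvg_cst|exact: cvg_id]|exact: cvg_cst].
exact: clamp_continuous.
Qed.

Section Broken.
Context {R : realType} {V : normedModType R}.
Implicit Types (x y z : V) (s : R).

(* The broken line from [x] (at [s <= 0]) through [y] (at [s = 1/2]) to [z] (at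
   [1 <= s]). *)
Definition broken x y z s : V :=
  let a := clamp (-2 * s + 1) in let c := clamp (2 * s - 1) in
  a *: x + (1 - a - c) *: y + c *: z.

(** At every time one of the two clamps vanishes. The strict [0 < c] lets [addZ_avoid] apply on the
    second half. *)
Lemma broken_cases x y z s :
  (exists2 a, 0 <= a <= 1 & broken x y z s = a *: x + (1 - a) *: y) \/
  (exists2 c, 0 < c & broken x y z s = (1 - c) *: y + c *: z).
Proof.
rewrite /broken; have [s2|s2] := leP (2 * s - 1) 0.
  left; exists (clamp (-2 * s + 1)); first by rewrite clamp_ge0 clamp_le1.
  by rewrite (clamp_le0 s2) subr0 scale0r addr0.
right; exists (clamp (2 * s - 1)).
  by rewrite /clamp lt_max lt_min s2 ltr01 orbT.
by rewrite (@clamp_le0 _ (-2 * s + 1)) ?subr0 ?scale0r ?add0r//; lra.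
Qed.

Lemma broken0 x y z : broken x y z 0 = x.
Proof.
rewrite /broken (@clamp_le0 _ (2 * 0 - 1)); last by lra.
by rewrite mulr0 add0r clamp1 subrr subr0 !scale0r !addr0 scale1r.
Qed.

Lemma broken1 x y z : broken x y z 1 = z.
Proof.
rewrite /broken (@clamp_le0 _ (-2 * 1 + 1)); last by lra.
rewrite (@clamp_ge1 _ (2 * 1 - 1)); last by lra.
by rewrite subr0 subrr !scale0r !add0r scale1r.
Qed.

Lemma broken_continuous (T : topologicalType) (x y z : T -> V) (s : T -> R) :
  continuous x -> continuous y -> continuous z -> continuous s ->
  continuous (fun t => broken (x t) (y t) (z t) (s t)).
Proof.
move=> cx cy cz cs t; rewrite /broken.
have ca : clamp (-2 * s t + 1) @[t --> t] --> clamp (-2 * s t + 1).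
  exact: (continuous_comp (cs t) (@clamp_affine_continuous R (-2) 1 _)).
have cc : clamp (2 * s t - 1) @[t --> t] --> clamp (2 * s t - 1).
  exact: (continuous_comp (cs t) (@clamp_affine_continuous R 2 (-1) _)).
apply: cvgD; last by apply: cvgZ => //; exact: cz.
apply: cvgD; apply: cvgZ => //; [exact: cx|apply: cvgB => //|exact: cy].
by apply: cvgB => //; exact: cvg_cst.
Qed.

Lemma addZ_avoid (u v : V) (c : R) : c != 0 ->
  (forall a : R, v != a *: u) -> u + c *: v != 0.
Proof.
move=> c0 vu; apply: contra (vu (- c^-1)); rewrite addr_eq0 => /eqP ->.
by rewrite scaleNr scalerN opprK scalerA mulVf// scale1r.
Qed.

Lemma segment_avoid (u v : V) (a : R) : u != 0 -> (forall a : R, v != a *: u) ->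
  a *: u + (1 - a) *: v != 0.
Proof.
move=> u0 vu; have [->|a1] := eqVneq a 1.
  by rewrite scale1r subrr scale0r addr0.
have a1' : 1 - a != 0 by rewrite subr_eq0 eq_sym.
apply: addZ_avoid => // b; apply: contra (vu (b * a)) => /eqP ->.
by rewrite scalerA.
Qed.

End Broken.

(** * Paths on the sphere *)

Section SpherePaths.
Context {R : realType} {q : nat}.
Local Notation V := 'rV[R]_q.+4.
Implicit Types u v w : V.

Lemma sphere_neq0 v : sphere v -> v != 0.
Proof. by move=> [_ v1]; rewrite -normr_eq0 v1 oner_neq0. Qed.

(** The segment from [u] to [v] may meet the origin, so the path detours through a point [w] outside
    their plane before being projected radially. *)
Lemma sphere_path u v : sphere u -> sphere v -> exists g : R -> V,
  [/\ continuous g, forall t, sphere (g t), g 0 = u & g 1 = v].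
Proof.
move=> Su Sv; have [w w0 wuv] := avoid_planes [:: (u, v)].
have wu a : w != a *: u.
  by have := wuv (u, v) a 0; rewrite mem_seq1 eqxx scale0r addr0; exact.
have wv a : w != a *: v.
  by have := wuv (u, v) 0 a; rewrite mem_seq1 eqxx scale0r add0r; exact.
have b0 t : broken u w v t != 0.
  have [[a _ ->]|[a _ ->]] := broken_cases u w v t.
    by apply: segment_avoid => //; exact: sphere_neq0.
  rewrite addrC -{2}[a](subKr 1) subKr.
  by apply: segment_avoid => //; exact: sphere_neq0.
exists (fun t => normalize (broken u w v t)); split => [|t||].
- apply: normalize_continuous => //.
  by apply: broken_continuous => t; [exact: cvg_cst|exact: cvg_cst|
    exact: cvg_cst|exact: cvg_id].
- apply: normalize_sphere => //; rewrite /broken !zsumD !zsumZ w0.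
  by case: Su Sv => -> _ [-> _]; rewrite !mulr0 !addr0.
- by rewrite broken0 normalize_id.
- by rewrite broken1 normalize_id.
Qed.

(** Radial projection moves [v] by the difference between [|v|] and [1 = |u|], which is at most
    [|u - v|]. *)
Lemma normalize_dist u v : sphere u -> v != 0 ->
  `|u - normalize v| <= 2 * `|u - v|.
Proof.
move=> [_ u1] v0; rewrite -[u - _](subrKA v) (le_trans (ler_normD _ _))//.
suff : `|v - normalize v| <= `|u - v| by rewrite mulr_natl mulr2n lerD2l.
have -> : v - normalize v = (`|v| - 1) *: normalize v.
  by rewrite scalerBl scale1r /normalize scalerA divff ?normr_eq0// scale1r.
rewrite normrZ /normalize normrZ normfV normr_id mulVf ?normr_eq0// mulr1.
by rewrite -u1 distrC ler_dist_dist.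
Qed.

Lemma sphere_short_path (e : R) : 0 < e -> exists2 d, 0 < d &
  forall u v, sphere u -> sphere v -> `|u - v| < d -> exists g : R -> V,
  [/\ continuous g, forall t, sphere (g t), g 0 = u, g 1 = v &
      forall t, `|u - g t| < e].
Proof.
(* The bound 1/2 keeps the segment away from the origin; [e / 2] absorbs the factor 2 of
   [normalize_dist]. *)
move=> e0; pose d := Num.min (2^-1) (e / 2).
have d0 : 0 < d by rewrite /d lt_min invr_gt0 divr_gt0// andbT.
exists d => // u v Su Sv uvd.
pose h t := u + clamp t *: (v - u).
have hu t : `|u - h t| <= `|u - v|.
  rewrite /h opprD addrA subrr add0r normrN normrZ distrC ler_piMl//.
  by rewrite ger0_norm ?clamp_ge0// clamp_le1.
have h0 t : h t != 0.
  apply/eqP => ht; have := hu t; rewrite ht subr0 (Su.2) => uv1.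
  move: uvd; rewrite lt_min => /andP[uv2 _]; lra.
exists (fun t => normalize (h t)); split => [|t|||t].
- apply: normalize_continuous => // t; apply: cvgD; first exact: cvg_cst.
  by apply: cvgZ; [exact: clamp_continuous|exact: cvg_cst].
- apply: normalize_sphere => //.
  by rewrite /h zsumD zsumZ zsumD -[- u]scaleN1r zsumZ Su.1 Sv.1 !(mulr0, addr0).
- by rewrite /h clamp0 scale0r addr0 normalize_id.
- by rewrite /h clamp1 scale1r addrC subrK normalize_id.
- rewrite (le_lt_trans (normalize_dist _ _))//.
  rewrite (@le_lt_trans _ _ (2 * `|u - v|)) ?ler_pM2l//.
  by move: uvd; rewrite lt_min => /andP[_]; rewrite ltr_pdivlMr// mulrC.
Qed.

End SpherePaths.

(** * Simple connectedness of the sphere *)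

Section SimplyConnected.
Context {R : realType} {q : nat}.
Local Notation V := 'rV[R]_q.+4.

(** The vertex [w k] is reached at time [k]. Summing clamped increments makes continuity immediate,
    with no gluing of pieces. *)
Definition polyline (w : nat -> V) (N : nat) (y : R) : V :=
  w 0%N + \sum_(0 <= k < N) clamp (y - k%:R) *: (w k.+1 - w k).

(** The increments before [j] are complete and telescope; those after [j] have not started. *)
Lemma polyline_cell (w : nat -> V) (N j : nat) (y : R) :
  (j < N)%N -> j%:R <= y <= j.+1%:R ->
  polyline w N y = (1 - (y - j%:R)) *: w j + (y - j%:R) *: w j.+1.
Proof.
move=> jN /andP[jy yj]; rewrite /polyline (big_cat_nat (n := j)) ?(ltnW jN)//=.
have -> : \sum_(0 <= k < j) clamp (y - k%:R) *: (w k.+1 - w k) = w j - w 0%N.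
  rewrite -telescope_sumr//; apply: eq_big_nat => k /andP[_ kj].
  rewrite clamp_ge1 ?scale1r// lerBrDl natr1 (le_trans _ jy)// ler_nat//.
rewrite big_ltn// [X in _ + (_ + (_ + X))]big_nat_cond big1 => [|k].
  rewrite clamp_id; last first.
    by rewrite subr_ge0 jy lerBlDl natr1.
  rewrite addr0 addrA [w 0%N + _]addrC subrK scalerBr [(1 - _) *: _]scalerBl.
  by rewrite scale1r addrA addrAC.
rewrite andbT => /andP[jk _]; rewrite clamp_le0 ?scale0r// subr_le0.
by rewrite (le_trans yj)// ler_nat.
Qed.

Lemma polyline_end w N : polyline w N N%:R = w N.
Proof.
case: N => [|N]; first by rewrite /polyline big_geq ?addr0.
rewrite (polyline_cell _ (ltnSn N)) ?lexx ?ler_nat ?leqnSn//.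
by rewrite -natr1 [_ + 1]addrC addrK subrr scale0r scale1r add0r.
Qed.

Lemma polyline_continuous w N : continuous (polyline w N).
Proof.
have ck k : continuous (fun y : R => clamp (y - k%:R)).
  by move=> y; under eq_fun do rewrite -[X in X - _]mul1r;
    exact: clamp_affine_continuous.
rewrite /polyline => y; apply: cvgD; first exact: cvg_cst.
apply: (@continuous_big V nat +%R 0 predT add_continuous) => k _ {}y.
by apply: cvgZ; [exact: ck|exact: cvg_cst].
Qed.

Lemma nat_cell (N : nat) (y : R) : (0 < N)%N -> 0 <= y <= N%:R ->
  exists2 j, (j < N)%N & j%:R <= y <= j.+1%:R.
Proof.
case: N => // N _ /andP[y0 yN].
elim: N yN => [|N IH] yN; first by exists 0%N; rewrite ?y0.
have [/IH[j jN jy]|/ltW Ny] := leP y N.+1%:R; first by exists j => //; exact: ltnW.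
by exists N.+1 => //; rewrite Ny.
Qed.

(* A loop is first deformed to a fine inscribed polygon, which lies in finitely
   many planes, and then along segments to a vector [v] outside those planes;
   both deformations avoid the origin. *)
Lemma sphere_null (f : R -> V) : continuous f -> (forall x, sphere (f x)) ->
  f 0 = f 1 -> exists (F : R * R -> V) (c : V),
  [/\ continuous F, forall u, sphere (F u),
      forall x, 0 <= x <= 1 -> F (0, x) = f x,
      forall x, F (1, x) = c & forall s, F (s, 0) = F (s, 1)].
Proof.
move=> cf Sf f01.
have [d d0 fd] := compact_uniform (@segment_compact R 0 1) cf
  (ltac:(lra) : 0 < 4^-1 :> R).
have [N N0 Nd] : exists2 N, (0 < N)%N & N%:R^-1 < d.
  have [n /= nd] := ltr_add_invr d0; exists n.+1 => //.
  by rewrite add0r in nd.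
have N0R : N%:R != 0 :> R by rewrite pnatr_eq0 -lt0n.
pose w k := f (k%:R / N%:R).
pose g x := polyline w N (N%:R * x).
have cell (x : R) : 0 <= x <= 1 -> exists j, (j < N)%N /\ exists th : R,
    [/\ 0 <= th <= 1, g x = (1 - th) *: w j + th *: w j.+1,
        `|f x - w j| <= 4^-1 & `|f x - w j.+1| <= 4^-1].
  move=> x01; have [||j jN /andP[jx xj]] := @nat_cell N (N%:R * x) => //.
    move/andP: x01 => [x0 x1]; rewrite mulr_ge0//=.
    by rewrite ler_piMr.
  have close k : `|N%:R * x - k%:R| <= 1 -> `|f x - w k| <= 4^-1.
    move=> Nxk; apply: ltW; suff : ball (f x) 4^-1 (w k) by rewrite -ball_normE.
    apply: fd; first by rewrite /= in_itv.
    rewrite -ball_normE /=; apply: le_lt_trans Nd.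
    rewrite -(ler_pM2l (_ : 0 < N%:R)) ?ltr0n// divff// -[X in X * _]ger0_norm//.
    by rewrite -normrM mulrBr mulrCA divff// mulr1.
  exists j; split => //; exists (N%:R * x - j%:R); split.
  - by rewrite subr_ge0 jx lerBlDl natr1.
  - by rewrite /g (polyline_cell _ jN)// jx.
  - by apply: close; rewrite ger0_norm ?subr_ge0// lerBlDl natr1.
  - apply: close; rewrite ler0_norm ?subr_le0// opprB lerBlDr -natr1.
    by rewrite addrC lerD2l.
have [v v0 vw] := avoid_planes [seq (w k, w k.+1) | k <- iota 0 N].
pose H (u : R * R) := broken (f (clamp u.2)) (g (clamp u.2)) v u.1.
have c01 (x : R) : 0 <= clamp x <= 1 by rewrite clamp_ge0 clamp_le1.
have H0 u : H u != 0.
  have [j [jN [th [/andP[th0 th1] gE fj fj1]]]] := cell (clamp u.2) (c01 u.2).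
  rewrite /H; set x := clamp u.2 in gE fj fj1 *.
  have fg : `|f x - g x| <= 4^-1.
    have -> : f x - g x = (1 - th) *: (f x - w j) + th *: (f x - w j.+1).
      by rewrite gE !scalerBr addrACA -scalerDl subrK scale1r opprD.
    rewrite (le_trans (ler_normD _ _))// !normrZ !ger0_norm ?subr_ge0//.
    have -> : 4^-1 = (1 - th) * 4^-1 + th * 4^-1 by rewrite -mulrDl subrK mul1r.
    by rewrite lerD// ler_wpM2l ?subr_ge0.
  (* On the first half, a zero would give [|g x| <= |f x - g x| <= 1/4], against [|f x| = 1]. On the
     second half, [g x] lies in the plane of [w j] and [w j.+1], which misses [v]. *)
  have [[a /andP[a0 a1] ->]|[c c0 ->]] := broken_cases (f x) (g x) v u.1.
    apply/eqP => /eqP; rewrite -[f x](subrK (g x)) scalerDr -addrA -scalerDl.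
    rewrite [a + _]addrC subrK scale1r addrC addr_eq0 => /eqP gfg.
    have ga : `|g x| <= `|f x - g x|.
      by rewrite {1}gfg normrN normrZ ger0_norm// ler_piMl.
    have := ler_dist_dist (f x) (g x); rewrite (Sf x).2 => /le_trans /(_ fg).
    have := le_trans ga fg; have := normr_ge0 (g x).
    by rewrite ler_norml => ? ? /andP[]; lra.
  apply: addZ_avoid; first by rewrite gt_eqF.
  move=> b; rewrite gE !scalerDr !scalerA.
  apply: (vw (w j, w j.+1)); apply: map_f; by rewrite mem_iota.
have cH : continuous H.
  have cc2 : continuous (fun u : R * R => clamp u.2).
    move=> u; apply: (@continuous_comp _ _ _ snd clamp); first exact: cvg_snd.
    exact: clamp_continuous.
  have cg : continuous g.
    have cN : continuous (fun x : R => N%:R * x).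
      by move=> x; apply: cvgM; [exact: cvg_cst|exact: cvg_id].
    by move=> x; exact: (continuous_comp (cN x) (@polyline_continuous w N _)).
  apply: broken_continuous => u.
  - exact: (continuous_comp (cc2 u) (cf _)).
  - exact: (continuous_comp (cc2 u) (cg _)).
  - exact: cvg_cst.
  - exact: cvg_fst.
have zg x : 0 <= x <= 1 -> zsum (g x) = 0.
  move=> /cell[j [_ [th [_ -> _ _]]]].
  by rewrite zsumD !zsumZ (Sf _).1 (Sf _).1 !mulr0 addr0.
exists (normalize \o H), (normalize v); split => [|u|x x01|x|s] /=.
- exact: normalize_continuous.
- apply: normalize_sphere => //.
  by rewrite /H /broken !zsumD !zsumZ (Sf _).1 zg ?c01// v0 !mulr0 !addr0.
- by rewrite /H/= broken0 clamp_id// normalize_id.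
- by rewrite /H/= broken1.
- congr normalize; rewrite /H/= clamp0 clamp1 f01; congr (broken _ _ _ _).
  have -> : g 0 = w 0%N.
    rewrite /g mulr0 (polyline_cell _ N0) ?lexx ?ler01//.
    by rewrite !subr0 scale0r scale1r addr0.
  have -> : g 1 = w N.
    by rewrite /g mulr1 polyline_end.
  by rewrite /w mul0r divff.
Qed.

End SimplyConnected.

(** * Orbit spaces of free isometric cyclic actions *)

(* An isometry [dact] of order [dord] preserving the compact set [dset], on which
   it generates a free action; [dgap] bounds from below the distance between
   distinct points of an orbit. *)
Record deck (R : realType) (V : normedModType R) := Deck {
  dset : set V;
  dact : V -> V;
  dord : nat;
  dgap : R;
  dset_compact : compact dset;
  dset_neq0 : dset !=set0;
  dact_set : forall a, dset a -> dset (dact a);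
  dact_iso : forall a b, `|dact a - dact b| = `|a - b|;
  dact_ord : forall a, iter dord dact a = a;
  dord_gt0 : (0 < dord)%N;
  dgap_gt0 : 0 < dgap;
  dact_gap : forall a k, dset a -> (0 < k < dord)%N ->
    dgap <= `|a - iter k dact a| }.

Section Orbits.
Context {R : realType} {V : normedModType R} (D : deck V).
Local Notation S := (dset D).
Local Notation act := (dact D).
Local Notation m := (dord D).

Definition orb (a : V) : set V := [set b | exists k, b = iter k act a].

Definition orbits := {A : set V | `[< exists2 a, S a & A = orb a >]}.

HB.instance Definition _ := SubChoice.on orbits.

Lemma iter_dset k a : S a -> S (iter k act a).
Proof. by move=> Sa; elim: k => //= k; exact: dact_set. Qed.

Lemma iter_iso k a b : `|iter k act a - iter k act b| = `|a - b|.
Proof. by elim: k => //= k <-; exact: dact_iso. Qed.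

Lemma iter_mul_dord k a : iter (k * m) act a = a.
Proof. by elim: k => // k IH; rewrite mulSn addnC iterD dact_ord. Qed.

Lemma iter_modn k a : iter k act a = iter (k %% m) act a.
Proof. by rewrite {1}(divn_eq k m) addnC iterD iter_mul_dord. Qed.

Lemma iter_inv k a : iter (k * m.-1) act (iter k act a) = a.
Proof. by rewrite -iterD addnC -mulnS prednK ?dord_gt0// iter_mul_dord. Qed.

Lemma orb_sym a b : orb a b -> orb b a.
Proof. by move=> [k ->]; exists (k * m.-1)%N; rewrite iter_inv. Qed.

Lemma orb_trans a b c : orb a b -> orb b c -> orb a c.
Proof. by move=> [k ->] [l ->]; exists (l + k)%N; rewrite iterD. Qed.

Lemma orb_eq a b : orb a b -> orb a = orb b.
Proof.
move=> ab; apply/seteqP; split=> c; last exact: orb_trans.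
by apply: orb_trans; exact: orb_sym.
Qed.

Definition orbits_base : orbits.
Proof.
exists (orb (sval (cid (dset_neq0 D)))); apply/asboolP.
by case: cid => a Sa; exists a.
Defined.

(** The quotient map, made total: a point outside [S] is sent to the base orbit. *)
Definition cls (a : V) : orbits := insubd orbits_base (orb a).

Lemma val_cls a : S a -> val (cls a) = orb a.
Proof. by move=> Sa; rewrite /cls val_insubd; case: asboolP => // -[]; exists a. Qed.

Lemma clsP (x : orbits) : exists2 a, S a & cls a = x.
Proof.
case: (x) (valP x) => A /= pA /asboolP[a Sa Aa]; exists a => //.
by apply: val_inj; rewrite val_cls.
Qed.

Lemma cls_eqP a b : S a -> S b -> (cls a = cls b) <-> exists k, b = iter k act a.
Proof.
move=> Sa Sb; split=> [ab|ab].
  suff : orb a b by [].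
  by rewrite -val_cls// ab val_cls//; exists 0%N.
by apply: val_inj; rewrite !val_cls//; exact: orb_eq.
Qed.

Lemma cls_iter k a : S a -> cls (iter k act a) = cls a.
Proof.
by move=> Sa; apply/esym/cls_eqP => //; [exact: iter_dset|exists k].
Qed.

Definition rep (x : orbits) : V := sval (cid2 (clsP x)).

Lemma rep_dset x : S (rep x).
Proof. by rewrite /rep; case: cid2. Qed.

Lemma repK x : cls (rep x) = x.
Proof. by rewrite /rep; case: cid2. Qed.

(** The distance between the orbits as sets: since [act] is an isometry, moving one representative
    is enough. The range ['I_m.+1] is nonempty by construction and its last index repeats
    [k = 0]. *)
Definition odist (x y : orbits) : R :=
  let d k := `|rep x - iter k act (rep y)| in
  d [arg min_(k < (ord0 : 'I_m.+1)) d k]%O.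

Lemma odistP x y : (exists k, odist x y = `|rep x - iter k act (rep y)|) /\
  forall k, odist x y <= `|rep x - iter k act (rep y)|.
Proof.
rewrite /odist; case: arg_minP => //= i _ mi; split; first by exists i.
move=> k; rewrite [iter k _ _]iter_modn.
have km : (k %% m < m.+1)%N by rewrite ltnW// ltnS ltn_pmod// dord_gt0.
exact: (mi (Ordinal km)).
Qed.

Lemma odist_le a b : S a -> S b -> odist (cls a) (cls b) <= `|a - b|.
Proof.
move=> Sa Sb.
have [k ->] : exists k, a = iter k act (rep (cls a)).
  by apply/cls_eqP; rewrite ?repK//; exact: rep_dset.
have [l ->] : exists l, b = iter l act (rep (cls b)).
  by apply/cls_eqP; rewrite ?repK//; exact: rep_dset.
rewrite !cls_iter ?repK; do ?exact: rep_dset.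
by rewrite -(iter_iso (k * m.-1)) iter_inv -iterD; exact: (odistP _ _).2.
Qed.

(** The minimum is attained at the chosen representatives, and a power of the isometry carries this
    pair to one starting at [a]. *)
Lemma odist_lift a y : S a -> exists b,
  [/\ S b, cls b = y & `|a - b| = odist (cls a) y].
Proof.
move=> Sa; have [[k ->] _] := odistP (cls a) y.
have [l al] : exists l, a = iter l act (rep (cls a)).
  by apply/cls_eqP; rewrite ?repK//; exact: rep_dset.
exists (iter l act (iter k act (rep y))); split.
- by do 2 apply: iter_dset; exact: rep_dset.
- by rewrite !cls_iter ?repK//; do ?apply: iter_dset; exact: rep_dset.
- by rewrite {1}al iter_iso.
Qed.

Lemma fibre_gap a b : S a -> S b -> cls a = cls b -> `|a - b| < dgap D -> a = b.
Proof.
move=> Sa Sb /(cls_eqP Sa Sb)[k ->]; rewrite iter_modn.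
have [->//|km] := posnP (k %% m); rewrite ltNge => /negP[].
by apply: dact_gap => //; rewrite km ltn_pmod// dord_gt0.
Qed.

Let odistxx x : odist x x = 0.
Proof.
rewrite -(repK x); apply/eqP; rewrite eq_le.
rewrite (le_trans (odist_le (rep_dset x) (rep_dset x))) ?subrr ?normr0//=.
by have [[k ->] _] := odistP (cls (rep x)) (cls (rep x)).
Qed.

Let odist_positivity x y : odist x y = 0 -> x = y.
Proof.
have [b [_ <-]] := odist_lift y (rep_dset x).
by rewrite repK => <- /normr0_eq0/eqP; rewrite subr_eq0 => /eqP <-; rewrite repK.
Qed.

Let odist_sym_le x y : odist y x <= odist x y.
Proof.
have [b [Sb <-]] := odist_lift y (rep_dset x); rewrite repK => <-.
by rewrite distrC -{1}(repK x) odist_le//; exact: rep_dset.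
Qed.

Let odist_sym x y : odist x y = odist y x.
Proof. by apply/eqP; rewrite eq_le !odist_sym_le. Qed.

(** Lift [y] near [rep x], then [z] near that lift, and use the triangle inequality of the norm. *)
Let odist_triangle y x z : odist x z <= odist x y + odist y z.
Proof.
have Sx := rep_dset x; have [b [Sb by_]] := odist_lift y Sx; rewrite repK => <-.
have [c [Sc cz]] := odist_lift z Sb; rewrite by_ => <-.
rewrite -{1}(repK x) -cz (le_trans (odist_le Sx Sc))//.
by rewrite -[rep x - c](subrKA b) ler_normD.
Qed.

HB.instance Definition _ := @isMetric.Build R orbits odist odistxx
  odist_positivity odist_sym odist_triangle.

Lemma mdist_cls_le a b : S a -> S b -> mdist (cls a) (cls b) <= `|a - b|.
Proof. exact: odist_le. Qed.

Lemma mdist_lift a y : S a -> exists b,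
  [/\ S b, cls b = y & `|a - b| = mdist (cls a) y].
Proof. exact: odist_lift. Qed.

Lemma cls_continuous (T : topologicalType) (f : T -> V) :
  continuous f -> (forall t, S (f t)) -> continuous (cls \o f).
Proof.
move=> cf Sf t; apply/metricType_numDomainType.cvgrPdist_lt => e e0.
have /cvgrPdist_lt/(_ _ e0) := cf t; apply: filterS => t' /=.
exact/le_lt_trans/mdist_cls_le.
Qed.

Lemma orbits_compact : compact [set: orbits].
Proof.
have <- : cls @` S = [set: orbits].
  by apply/seteqP; split=> // x _; have [a] := clsP x; exists a.
apply: continuous_compact; last exact: dset_compact.
apply/subspace_sigL_continuousP.
have cval : continuous (set_val : S -> V) by exact: initial_continuous.
by apply: (cls_continuous cval) => t; exact: set_valP.
Qed.

(* [b t] is the point of the fibre of [h t] closest to [a t]. *)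
Lemma lift_step (T : topologicalType) (a : T -> V) (h : T -> orbits) :
  continuous a -> (forall t, S (a t)) -> continuous h ->
  (forall t, mdist (cls (a t)) (h t) < dgap D / 3) ->
  exists b : T -> V, [/\ continuous b, forall t, S (b t),
    forall t, cls (b t) = h t & forall t, `|a t - b t| = mdist (cls (a t)) (h t)].
Proof.
move=> ca Sa ch ah.
have [b /all_and3[Sb bh ab]] := choice (fun t => mdist_lift (h t) (Sa t)).
exists b; split => // t; apply/cvgrPdist_lt => e e0.
(* The route from [c] through [b t], [a t] and [a t'] to [b t'] is shorter than 1/6 + 1/3 + 1/6 +
   1/3 of the gap, so [c] and [b t'], both over [h t'], coincide. *)
pose r := Num.min e (dgap D / 6).
have r0 : 0 < r by rewrite lt_min e0 divr_gt0// dgap_gt0.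
have /cvgrPdist_lt/(_ _ r0) at_ := ca t.
have /metricType_numDomainType.cvgrPdist_lt/(_ _ r0) ht := ch t.
near=> t'.
have att' : `|a t - a t'| < r by near: t'.
have htt' : mdist (h t) (h t') < r by near: t'.
have [c [Sc ch' bc]] := mdist_lift (h t') (Sb t).
rewrite bh in bc; rewrite -bc in htt'.
have <- : c = b t'.
  apply: fibre_gap => //; first by rewrite ch' bh.
  have := ler_distD (b t) c (b t'); have := ler_distD (a t) (b t) (b t').
  have := ler_distD (a t') (a t) (b t'); rewrite [`|b t - a t|]distrC.
  rewrite [`|c - b t|]distrC !ab.
  have := ah t; have := ah t'; have := dgap_gt0 D.
  move: att' htt'; rewrite !lt_min => /andP[_ ?] /andP[_ ?]; lra.
by move: htt'; rewrite lt_min => /andP[].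
Unshelve. all: by end_near. Qed.

End Orbits.

(** * Torsion loops *)

(* Loops and homotopies are total functions on [R] and [R * R], but only their
   values on [[0, 1]] and [[0, 1]^2] matter. *)
Definition null_loop (R : realType) (X : topologicalType) (f : R -> X) :=
  exists (F : R * R -> X) (c : X),
  [/\ continuous F, forall x, 0 <= x <= 1 -> F (0, x) = f x,
      forall x, 0 <= x <= 1 -> F (1, x) = c &
      forall s, 0 <= s <= 1 -> F (s, 0) = F (s, 1)].

(* [fun x => f (n%:R * x)] is the [n]-th power of the [1]-periodic loop [f]. *)
Definition has_torsion (R : realType) (X : topologicalType) (n : nat) :=
  exists f : R -> X, [/\ continuous f, forall x, f (x + 1) = f x,
    ~ null_loop f & null_loop (fun x => f (n%:R * x))].

Lemma null_loop_comp (R : realType) (X Y : topologicalType) (f : R -> X)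
    (g : X -> Y) : continuous g -> null_loop f -> null_loop (g \o f).
Proof.
move=> cg [F [c [cF F0 F1 Fs]]]; exists (g \o F), (g c); split => [u|x|x|s] h.
- exact: (continuous_comp (cF u) (cg _)).
- by rewrite /= F0.
- by rewrite /= F1.
- by rewrite /= Fs.
Qed.

(** * Lifting paths and homotopies along the quotient map *)

Section Lifting.
Context {R : realType} {V : normedModType R} (D : deck V).
Local Notation S := (dset D).
Local Notation act := (dact D).
Local Notation m := (dord D).
Local Notation L := (orbits D).
Local Notation cls := (cls D).

(** Two points of one fibre are equal or at least [dgap D] apart, so the continuous distance
    [|a x - b x|], starting at 0, cannot cross half the gap. *)
Lemma lift_unique (a b : R -> V) (c : R) : 0 <= c ->
  continuous a -> continuous b ->
  (forall x, 0 <= x <= c -> [/\ S (a x), S (b x) & cls (a x) = cls (b x)]) ->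
  a 0 = b 0 -> a c = b c.
Proof.
move=> c0 ca cb ab ab0; have g0 := dgap_gt0 D.
have c01 : 0 <= c <= c by rewrite c0 lexx.
have [Sa Sb cab] := ab _ c01.
apply: (fibre_gap Sa Sb cab); rewrite ltNge; apply/negP => gc.
pose d x := `|a x - b x|; rewrite -/(d c) in gc.
have cd : {within `[0, c], continuous d}.
  apply: continuous_subspaceT => x; apply: cvg_norm.
  by apply: cvgB; [exact: ca|exact: cb].
have [|x] := @IVT R d 0 c (dgap D / 2) c0 cd.
  have -> : d 0 = 0 by rewrite /d ab0 subrr normr0.
  rewrite (min_idPl _) ?(max_idPr _) ?normr_ge0// divr_ge0 ?ltW//=.
  by rewrite (lt_le_trans _ gc)// ltr_pdivrMr// ltr_pMr// ltr1n.
rewrite in_itv /= => /ab[Sax Sbx cx] dx.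
have abx : a x = b x.
  by apply: (fibre_gap Sax Sbx cx); rewrite [ltLHS]dx ltr_pdivrMr// ltr_pMr// ltr1n.
by move: dx; rewrite /d abx subrr normr0; lra.
Qed.

(* The square is contracted to its corner: the lift of [u |-> F (k / N * u)] is
   obtained from that of [u |-> F ((k - 1) / N * u)] by [lift_step]. *)
Lemma lift_square (F : R * R -> L) (e : V) :
  continuous F -> S e -> cls e = F (0, 0) ->
  exists G : R * R -> V, [/\ continuous G, forall u, S (G u), G (0, 0) = e &
    forall s x, 0 <= s <= 1 -> 0 <= x <= 1 -> cls (G (s, x)) = F (s, x)].
Proof.
move=> cF Se eF.
have g3 : 0 < dgap D / 3 by rewrite divr_gt0// dgap_gt0.
have [d d0 Fd] := compact_uniform
  (compact_setX (@segment_compact R 0 1) (@segment_compact R 0 1)) cF g3.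
have [N N0 Nd] : exists2 N, (0 < N)%N & N%:R^-1 < d.
  have [n /= nd] := ltr_add_invr d0; exists n.+1 => //.
  by rewrite add0r in nd.
have N0R : 0 < N%:R :> R by rewrite ltr0n.
(* The clamped square scaled by [k / N] towards the corner [(0, 0)]; consecutive scalings differ by
   at most [1 / N < d]. *)
pose pt k (u : R * R) := (k%:R / N%:R * clamp u.1, k%:R / N%:R * clamp u.2).
have cpt k : continuous (pt k).
  apply: pair_continuous; apply: (comp_continuous _ (@lmul_continuous _ _));
    apply: (comp_continuous _ clamp_continuous).
    exact: fst_continuous.
  exact: snd_continuous.
have step k u : (k < N)%N -> mdist (F (pt k u)) (F (pt k.+1 u)) < dgap D / 3.
  move=> kN.
  have in01 (x : R) : 0 <= k%:R / N%:R * clamp x <= 1.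
    rewrite mulr_ge0 ?divr_ge0 ?ler0n ?clamp_ge0//=.
    rewrite mulr_ile1 ?divr_ge0 ?ler0n ?clamp_ge0 ?clamp_le1//.
    by rewrite ler_pdivrMr// mul1r ler_nat ltnW.
  have near1 (x : R) : ball (k%:R / N%:R * clamp x) d (k.+1%:R / N%:R * clamp x).
    rewrite -ball_normE /= -mulrBl -mulrBl -opprB -natr1 addrC addKr.
    rewrite normrM normrM normrN normr1 mul1r !ger0_norm ?clamp_ge0 ?invr_ge0 ?ler0n//.
    by rewrite (le_lt_trans _ Nd)// ler_piMr ?clamp_le1// invr_ge0 ler0n.
  have := Fd (pt k u) (pt k.+1 u); rewrite ballEmdist; apply; split => /=;
    rewrite ?in_itv//=; exact: near1.
suff [G [cG SG G0 GF]] : exists G : R * R -> V,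
    [/\ continuous G, forall u, S (G u), G (0, 0) = e &
        forall u, cls (G u) = F (pt N u)].
  exists G; split => // s x s01 x01; rewrite GF /pt /= divff ?gt_eqF//.
  by rewrite !mul1r !clamp_id.
have : (N <= N)%N by [].
elim: {1 3}N => [_|k IH kN].
  exists (fun=> e); split => // [u|u]; first exact: cvg_cst.
  by rewrite eF /pt !mul0r.
have [G [cG SG G0 GF]] := IH (ltnW kN).
have [||b [cb Sb bF Gb]] := @lift_step R V D _ G (F \o pt k.+1) cG SG.
- exact: comp_continuous (cpt k.+1) cF.
- by move=> u; rewrite GF; exact: step.
exists b; split => //.
(* The corner is fixed by every scaling, so its lift moves by distance 0 and remains [e]. *)
have := Gb (0, 0); rewrite GF /= /pt /= !clamp0 !mulr0 mdistxx G0.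
by move=> /normr0_eq0/eqP; rewrite subr_eq0 => /eqP.
Qed.

Lemma lift_path (f : R -> L) (e : V) : continuous f -> S e -> cls e = f 0 ->
  exists g : R -> V, [/\ continuous g, forall x, S (g x), g 0 = e &
    forall x, 0 <= x <= 1 -> cls (g x) = f x].
Proof.
move=> cf Se ef.
have [|G [cG SG G0 Gf]] := @lift_square (f \o snd) e _ Se ef.
  exact: comp_continuous (@snd_continuous _ _) cf.
exists (fun x => G (0, x)); split => // [|x x01]; last first.
  by rewrite Gf// lexx ler01.
apply: (comp_continuous _ cG).
by apply: pair_continuous; [exact: cst_continuous|exact: id_continuous].
Qed.

(** Lift the null-homotopy. Its edge [s = 1] lifts a constant path, hence is constant; the sides
    [x = 0] and [x = 1] lift the same path and meet at [s = 1], so they also agree at [s = 0], where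
    the edge is [g]. *)
Lemma lift_null_closed (f : R -> L) (g : R -> V) : null_loop f ->
  continuous g -> (forall x, S (g x)) ->
  (forall x, 0 <= x <= 1 -> cls (g x) = f x) -> g 0 = g 1.
Proof.
move=> [F [c [cF F0 F1 Fs]]] cg Sg gf.
have i0 : 0 <= (0 : R) <= 1 by rewrite lexx ler01.
have i1 : 0 <= (1 : R) <= 1 by rewrite lexx ler01.
have [|G [cG SG G0 GF]] := lift_square cF (Sg 0); first by rewrite F0// gf.
have cG1 (s : R) : continuous (fun x : R => G (s, x)).
  apply: (comp_continuous _ cG).
  by apply: pair_continuous; [exact: cst_continuous|exact: id_continuous].
have cG2 (x : R) : continuous (fun s : R => G (1 - s, x)).
  apply: (comp_continuous _ cG).
  apply: pair_continuous; last exact: cst_continuous.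
  by move=> s; apply: cvgB; [exact: cvg_cst|exact: cvg_id].
have <- : G (0, 1) = g 1.
  apply: (@lift_unique (fun x => G (0, x)) g) => // x x01; split => //.
  by rewrite GF// F0// gf.
have G11 : G (1, 1) = G (1, 0).
  apply: (@lift_unique (fun x => G (1, x)) (fun=> G (1, 0))) => //.
    by move=> x; exact: cvg_cst.
  by move=> x x01; split => //; rewrite !GF// !F1.
(* The sides are run backwards, because [lift_unique] compares lifts from time 0 on. *)
suff : G (1 - 1, 0) = G (1 - 1, 1) by rewrite subrr G0.
apply: (@lift_unique (fun s => G (1 - s, 0)) (fun s => G (1 - s, 1))) => //.
  move=> s /andP[s0 s1]; have s01 : 0 <= 1 - s <= 1 by lra.
  by split => //; rewrite !GF// Fs.
by rewrite subr0.
Qed.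

(** Simple connectedness of [S], in terms of free homotopies. *)
Definition loops_null := forall g : R -> V, continuous g ->
  (forall x, S (g x)) -> g 0 = g 1 -> exists (F : R * R -> V) (c : V),
  [/\ continuous F, forall u, S (F u), forall x, 0 <= x <= 1 -> F (0, x) = g x,
      forall x, F (1, x) = c & forall s, F (s, 0) = F (s, 1)].

Lemma null_loop_lift (f : R -> L) (g : R -> V) : loops_null ->
  continuous g -> (forall x, S (g x)) -> g 0 = g 1 ->
  (forall x, 0 <= x <= 1 -> cls (g x) = f x) -> null_loop f.
Proof.
move=> ln cg Sg g01 gf; have [F [c [cF SF F0 F1 Fs]]] := ln g cg Sg g01.
exists (cls \o F), (cls c); split => [|x x01|x x01|s s01] /=.
- exact: cls_continuous.
- by rewrite F0// gf.
- by rewrite F1.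
- by rewrite Fs.
Qed.

Lemma iter_act_continuous k : continuous (iter k act).
Proof.
move=> a; apply/cvgrPdist_lt => e e0.
have /cvgrPdist_lt/(_ e e0) : b @[b --> a] --> a by exact: cvg_id.
by apply: filterS => b /=; rewrite iter_iso.
Qed.

Lemma period1n (T : Type) (f : R -> T) (x : R) (n : nat) :
  (forall x, f (x + 1) = f x) -> f (x + n%:R) = f x.
Proof. by move=> fp; elim: n => [|n IH]; rewrite ?addr0// -natr1 addrA fp. Qed.

(* A loop whose [n]-th power is null lifts to a path from [e] to [act^k e] with
   [act^(n k) e = e]; hence [m] divides [n * k], then [k], and the lift is closed. *)
Lemma no_torsion (n : nat) : loops_null -> (0 < n)%N -> coprime n m ->
  ~ has_torsion R L n.
Proof.
move=> ln n0 nm [f [cf fp fnull fnnull]]; apply: fnull.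
have n0R : 0 < n%:R :> R by rewrite ltr0n.
pose h x := f (n%:R * x).
have ch : continuous h.
  exact: comp_continuous (@lmul_continuous _ _) cf.
have [|g [cg Sg g0 gh]] := lift_path ch (rep_dset (h 0)); first by rewrite repK.
have g01 := lift_null_closed fnnull cg Sg gh.
have inv01 : 0 <= n%:R^-1 :> R by rewrite invr_ge0 ler0n.
have inv1 : n%:R^-1 <= 1 :> R by rewrite invf_le1// ler1n.
have [k gk] : exists k, g n%:R^-1 = iter k act (g 0).
  apply/cls_eqP => //; rewrite !gh ?lexx ?ler01 ?inv01//.
  by rewrite /h mulr0 divff ?gt_eqF// -[1 in RHS]add0r fp.
(* By periodicity of [f], the paths [g (x + j / n)] and [act^(j k) (g x)] lift the same path on
   [[0, 1/n]]; they agree at 0 by induction. *)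
have gj j : (j <= n)%N -> g (j%:R / n%:R) = iter (j * k) act (g 0).
  elim: j => [_|j IH jn]; first by rewrite mul0r.
  rewrite -natr1 mulrDl div1r addrC mulSn iterD.
  have -> : iter k act (iter (j * k) act (g 0)) =
            iter (j * k) act (g n%:R^-1).
    by rewrite gk -!iterD addnC.
  apply: (@lift_unique (fun x => g (x + j%:R / n%:R))
    (fun x => iter (j * k) act (g x))) => //.
  - apply: (comp_continuous _ cg) => x.
    by apply: cvgD; [exact: cvg_id|exact: cvg_cst].
  - exact: comp_continuous cg (@iter_act_continuous _).
  - move=> x /andP[x0 xn]; split; [by []|exact: iter_dset|].
    rewrite cls_iter// !gh.
    + by rewrite /h mulrDr mulrCA divff ?gt_eqF// mulr1 period1n.
    + by rewrite x0 (le_trans xn).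
    + rewrite addr_ge0 ?divr_ge0 ?ler0n//=.
      rewrite (@le_trans _ _ (n%:R^-1 + j%:R / n%:R)) ?lerD2r//.
      by rewrite -{1}[n%:R^-1]mul1r -mulrDl ler_pdivrMr// mul1r addrC natr1 ler_nat.
  - by rewrite add0r IH// ltnW.
have mk : (m %| k)%N.
  rewrite -(@Gauss_dvdr m n k) 1?coprime_sym//.
  have := gj n (leqnn n); rewrite divff ?gt_eqF// -g01 iter_modn => gn.
  rewrite /dvdn; apply/negPn/negP => nk0.
  have := @dact_gap _ _ D (g 0) ((n * k) %% m) (Sg 0).
  rewrite lt0n nk0 ltn_pmod ?dord_gt0// -gn subrr normr0 => /(_ isT).
  by rewrite leNgt dgap_gt0.
(* The piece of [g] over [[0, 1/n]], rescaled to a lift of [f] itself. *)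
pose g' x := g (n%:R^-1 * x).
apply: (@null_loop_lift f g') => //.
- exact: comp_continuous (@lmul_continuous _ _) cg.
- by move=> x; exact: Sg.
- by rewrite /g' mulr0 mulr1 gk; case/dvdnP: mk => l ->; rewrite iter_mul_dord.
- move=> x /andP[x0 x1]; rewrite /g' gh; last first.
    by rewrite mulr_ge0//= mulr_ile1.
  by rewrite /h mulrA divff ?gt_eqF// mul1r.
Qed.

End Lifting.

(** * Generalized lens spaces *)

Section RowNorm.
Context {R : realType} {n : nat}.
Implicit Types v : 'rV[R]_n.

Lemma row_norm_le v (c : R) : 0 <= c -> (forall i, `|v ord0 i| <= c) -> `|v| <= c.
Proof.
move=> c0 vc; rewrite [leLHS]/Num.Def.normr/= mx_normrE (bigmax_le _ c0)//=.
by move=> [i j] _; rewrite ord1.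
Qed.

Lemma coord_norm_le v i : `|v ord0 i| <= `|v|.
Proof.
rewrite [leRHS]/Num.Def.normr/= mx_normrE.
exact: (le_bigmax _ (fun ij : 'I_1 * 'I_n => `|v ij.1 ij.2|) (ord0, i)).
Qed.

Lemma row_continuous (T : topologicalType) (f : T -> 'rV[R]_n) :
  (forall i, continuous (fun t => f t ord0 i)) -> continuous f.
Proof.
move=> cf t; apply/cvgrPdist_le => e e0.
have : \forall t' \near t, forall i, `|f t ord0 i - f t' ord0 i| <= e.
  by apply: filter_forall => i; move: (cf i t) => /cvgrPdist_le/(_ _ e0).
apply: filterS => t' te; apply: row_norm_le; first exact: ltW.
by move=> i; rewrite !mxE.
Qed.

End RowNorm.

Section Shift.
Context {R : realType} {q : nat}.
Local Notation p := q.+4.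
Local Notation V := 'rV[R]_p.
Implicit Types (u v : V) (i j : 'I_p).

(* Indices live in the ring ['I_p] of integers modulo [p]. *)
Definition shift v : V := \row_i v ord0 (i + 1).

Lemma iter_shiftE k v i : iter k shift v ord0 i = v ord0 (i + k%:R).
Proof.
elim: k i => [|k IH] i; first by rewrite addr0.
by rewrite iterS mxE IH -addrA nat1r.
Qed.

Lemma shiftB u v : shift u - shift v = shift (u - v).
Proof. by apply/rowP => i; rewrite !mxE. Qed.

Lemma shiftZ (a : R) v : shift (a *: v) = a *: shift v.
Proof. by apply/rowP => i; rewrite !mxE. Qed.

Lemma shift_norm v : `|shift v| = `|v|.
Proof.
apply/eqP; rewrite eq_le; apply/andP; split.
  by apply: row_norm_le => // i; rewrite mxE coord_norm_le.
apply: row_norm_le => // i; have := coord_norm_le (shift v) (i - 1).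
by rewrite mxE subrK.
Qed.

Lemma shift_zsum v : zsum (shift v) = zsum v.
Proof.
rewrite /zsum [RHS](reindex_inj (addIr (1 : 'I_p))).
by apply: eq_bigr => i _; rewrite mxE.
Qed.

Lemma shift_sphere v : sphere v -> sphere (shift v).
Proof. by case=> v0 v1; split; rewrite ?shift_zsum// shift_norm. Qed.

Lemma shift_iso u v : `|shift u - shift v| = `|u - v|.
Proof. by rewrite shiftB shift_norm. Qed.

Lemma shift_ord v : iter p shift v = v.
Proof.
apply/rowP => i; rewrite iter_shiftE.
by have -> : p%:R = 0 :> 'I_p; rewrite ?addr0//; exact: (@pchar_Zp p).
Qed.

(** Otherwise coordinates [k] apart differ by at most [1/p]. As [k] generates Z/p, any two
    coordinates differ by at most [(p - 1)/p]; since the coordinates sum to zero, each is an average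
    of such differences, so [|v| < 1]. *)
Lemma shift_gap v k : prime p -> sphere v -> (0 < k < p)%N ->
  p%:R^-1 <= `|v - iter k shift v|.
Proof.
move=> pp [v0 v1] /andP[k0 kp]; rewrite leNgt; apply/negP => vk.
have p0 : 0 < p%:R :> R by rewrite ltr0n.
have kunit : (k%:R : 'I_p) \is a GRing.unit.
  rewrite (@unitZpE p k)// prime_coprime//; apply/negP => /(dvdn_leq k0).
  by rewrite leqNgt kp.
have chain i t : `|v ord0 i - v ord0 (i + k%:R *+ t)| <= t%:R * p%:R^-1.
  elim: t => [|t IH]; first by rewrite mulr0n addr0 subrr normr0 mul0r.
  rewrite (le_trans (ler_distD (v ord0 (i + k%:R *+ t)) _ _))//.
  rewrite -natr1 mulrDl mul1r lerD// (le_trans _ (ltW vk))//.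
  have := coord_norm_le (v - iter k shift v) (i + k%:R *+ t).
  by rewrite !mxE iter_shiftE -addrA -mulrSr.
have close i j : `|v ord0 i - v ord0 j| <= q.+3%:R * p%:R^-1.
  pose t : 'I_p := (j - i) / k%:R.
  have <- : i + k%:R *+ t = j.
    by rewrite -mulr_natr natr_Zp /t mulrC divrK// addrC subrK.
  rewrite (le_trans (chain i t))//.
  by rewrite ler_wpM2r ?invr_ge0 ?ler0n// ler_nat -ltnS.
have : `|v| <= q.+3%:R * p%:R^-1.
  apply: row_norm_le => [|i]; first by rewrite divr_ge0 ?ler0n.
  rewrite -(ler_pM2l p0) -[X in X * _]ger0_norm ?ler0n// -normrM.
  have -> : p%:R * v ord0 i = \sum_j (v ord0 i - v ord0 j).
    by rewrite sumrB -/(zsum v) v0 subr0 sumr_const card_ord mulr_natl.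
  rewrite (le_trans (ler_norm_sum _ _ _))//.
  rewrite (le_trans (ler_sum _ (fun j _ => close i j)))//.
  by rewrite sumr_const card_ord -[leLHS]mulr_natl.
by rewrite v1 ler_pdivlMr// mul1r ler_nat ltnn.
Qed.

Lemma sphere_neq_set0 : @sphere R q !=set0.
Proof.
have [v v0 vn] := @avoid_planes R q [:: (0, 0)].
exists (normalize v); apply: normalize_sphere => //.
by have := vn (0, 0) 0 0; rewrite mem_seq1 eqxx !scale0r addr0; exact.
Qed.

Definition sphere_deck (pp : prime p) : deck V := @Deck R V sphere shift p p%:R^-1
  sphere_compact sphere_neq_set0 shift_sphere shift_iso shift_ord (ltn0Sn _)
  (ltac:(by rewrite invr_gt0 ltr0n)) (fun v k => @shift_gap v k pp).

Lemma sphere_loops_null (pp : prime p) : loops_null (sphere_deck pp).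
Proof.
move=> g cg Sg g01; have [F [c [cF SF F0 F1 Fs]]] := sphere_null cg Sg g01.
by exists F, c.
Qed.

(** A function of period [p]. Its increments over successive unit steps sum to zero over a period,
    and advancing time by 1 shifts them cyclically; this gives an explicit path from a point to its
    shift. *)
Definition wave (y : R) : R := cos (pi *+ 2 * (y / p%:R)).

Lemma wave_period : periodic wave p%:R.
Proof.
move=> y; rewrite /wave [(y + _) / _]mulrDl divff ?pnatr_eq0// mulrDr mulr1.
exact: cosD2pi.
Qed.

Lemma wave_continuous : continuous wave.
Proof.
apply: (comp_continuous _ (@continuous_cos R)) => y.
apply: cvgM; first exact: cvg_cst.
by apply: cvgM; [exact: cvg_id|exact: cvg_cst].
Qed.

Lemma wave_Zp (y : R) i :
  wave (y + ((i + 1)%R : nat)%:R) = wave (y + i.+1%:R).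
Proof.
have -> : i + 1 = inZp i.+1 by rewrite -Zp_nat -natr1 natr_Zp.
have [ip|ip] := ltnP i.+1 p; first by rewrite /= modn_small.
have -> : i.+1 = p by apply/eqP; rewrite eqn_leq ip ltn_ord.
by rewrite /= modnn addr0 wave_period.
Qed.

(** Put [a = 2 pi / p], which lies strictly between 0 and [pi]. Equal cosines at [t - a], [t],
    [t + a] would give [sin t * sin a = 0] and [cos t * (1 - cos a) = 0], so [sin t = cos t = 0]. *)
Lemma wave_nonconst (y : R) : wave y = wave (y + 1) -> wave (y + 1) <> wave (y + 2).
Proof.
rewrite /wave; pose a : R := pi *+ 2 / p%:R; pose t : R := pi *+ 2 * ((y + 1) / p%:R).
have -> : pi *+ 2 * (y / p%:R) = t - a by rewrite /t /a; ring.
have -> : pi *+ 2 * ((y + 2) / p%:R) = t + a by rewrite /t /a; ring.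
rewrite -/t cosB cosD => h1 h2.
have sa : 0 < sin a.
  have pi0 := pi_gt0 R; apply: sin_gt0_pi; rewrite /a; apply/andP; split.
    by rewrite divr_gt0 ?ltr0n// pmulrn_lgt0.
  by rewrite ltr_pdivrMr ?ltr0n// mulr_natr ltr_pMn2l.
have ca : cos a < 1.
  rewrite ltNge; apply/negP => c1; have := cos2Dsin2 a; have := exprn_gt0 2 sa; nra.
have st : sin t = 0.
  have /eqP : sin t * sin a = 0 by lra.
  by rewrite mulf_eq0 (gt_eqF sa) orbF => /eqP.
have ct : cos t = 0.
  have /eqP : cos t * (1 - cos a) = 0 by lra.
  by rewrite mulf_eq0 subr_eq0 (gt_eqF ca) orbF => /eqP.
by have := cos2Dsin2 t; rewrite st ct; lra.
Qed.

Definition wave_row (x : R) : V :=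
  \row_i (wave (x + i.+1%:R) - wave (x + i%:R)).

Lemma wave_row_zsum x : zsum (wave_row x) = 0.
Proof.
rewrite /zsum /wave_row.
under eq_bigr do rewrite mxE.
rewrite -(big_mkord xpredT (fun i : nat => wave (x + i.+1%:R) - wave (x + i%:R))).
by rewrite telescope_sumr// wave_period addr0 subrr.
Qed.

Lemma wave_row_shift x : wave_row (x + 1) = shift (wave_row x).
Proof.
apply/rowP => i; rewrite !mxE wave_Zp -[_.+1%:R in RHS]natr1 addrA addrAC wave_Zp.
by rewrite -!addrA !nat1r.
Qed.

Lemma wave_row_neq0 x : wave_row x != 0.
Proof.
apply/eqP => /rowP w0; apply: (@wave_nonconst x).
  have := w0 0; rewrite !mxE => /eqP.
  by rewrite subr_eq0 addr0 => /eqP ->.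
have := w0 1; rewrite !mxE => /eqP.
by rewrite subr_eq0 => /eqP ->.
Qed.

Lemma wave_row_continuous : continuous wave_row.
Proof.
have cw (k : nat) : continuous (fun x : R => wave (x + k%:R)).
  apply: (comp_continuous _ wave_continuous) => x.
  by apply: cvgD; [exact: cvg_id|exact: cvg_cst].
apply: row_continuous => i x; rewrite /wave_row.
under eq_fun do rewrite mxE.
by apply: cvgB; exact: cw.
Qed.

(* The path [g] joins [g 0] to [shift (g 0)], so it projects to a loop that is not
   null, while its [p]-th power lifts to a closed path. *)
Lemma sphere_torsion (pp : prime p) : has_torsion R (orbits (sphere_deck pp)) p.
Proof.
pose D := sphere_deck pp; pose g x := normalize (wave_row x).
have cg : continuous g.
  by apply: normalize_continuous; [exact: wave_row_continuous|exact: wave_row_neq0].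
have Sg x : dset D (g x).
  by apply: normalize_sphere; [exact: wave_row_zsum|exact: wave_row_neq0].
have g1 x : g (x + 1) = shift (g x).
  by rewrite /g wave_row_shift /normalize shift_norm shiftZ.
exists (cls D \o g); split => [|x||].
- exact: cls_continuous.
- by rewrite /= g1; exact: (@cls_iter _ _ D 1).
- move=> fnull; have := lift_null_closed fnull cg Sg (fun _ _ => erefl).
  rewrite -[X in _ = g X]add0r g1 => g01.
  have := @dact_gap _ _ D (g 0) 1 (Sg 0) isT.
  by rewrite /= -g01 subrr normr0 leNgt (dgap_gt0 D).
- apply: (@null_loop_lift _ _ D _ (fun x => g (p%:R * x)) (@sphere_loops_null pp)) => //.
  + exact: comp_continuous (@lmul_continuous R p%:R) cg.
  + rewrite mulr0 mulr1 -[p%:R]add0r.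
    have gn n : g (0 + n%:R) = iter n shift (g 0).
      by elim: n => [|n IH]; rewrite ?addr0// -natr1 addrA g1 IH.
    by rewrite gn shift_ord.
Qed.

End Shift.

(** * Countable products *)

Section Paths.
Context (R : realType).

Definition path_connected (X : topologicalType) := forall x y : X,
  exists g : R -> X, [/\ continuous g, g 0 = x & g 1 = y].

(** Only paths from the centre [x] are required, a form that passes easily to quotients and
    products. *)
Definition locally_path_joined (X : topologicalType) :=
  forall (x : X) (U : set X), nbhs x U -> \forall y \near x,
  exists g : R -> X, [/\ continuous g, g 0 = x, g 1 = y & forall t, U (g t)].

Lemma path_image_connected (X : topologicalType) (g : R -> X) :
  continuous g -> connected (range g).
Proof.
move=> cg; apply: connected_continuous_connected.
  by apply/connected_intervalP.
exact: continuous_subspaceT.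
Qed.

Lemma path_connected_connected (X : topologicalType) :
  [set: X] !=set0 -> path_connected X -> connected [set: X].
Proof.
move=> [x _] pX.
suff -> : [set: X] = connected_component setT x by exact: component_connected.
apply/esym/seteqP; split => // y _; have [g [cg g0 g1]] := pX x y.
exists (range g); last by exists 1.
by split => //; [exists 0|exact: path_image_connected].
Qed.

(** Components of the open set [U°] are open, since nearby points are joined by paths inside
    [U°]. *)
Lemma locally_path_joined_connected (X : topologicalType) :
  locally_path_joined X -> locally_connected X.
Proof.
move=> lX x U xU; exists (connected_component U° x); split.
- rewrite openE => y Cy; have Uy := connected_component_sub Cy.
  have : nbhs y U° by apply: open_nbhs_nbhs; split => //; exact: open_interior.
  move=> /lX; apply: filterS => z [g [cg g0 g1 gU]].
  apply: connected_component_trans Cy _; exists (range g); last by exists 1.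
  split; first by exists 0.
    by move=> _ [t _ <-]; exact: gU.
  exact: path_image_connected.
- exact: component_connected.
- exact: connected_component_refl.
- by apply: subset_trans (@connected_component_sub _ _ _) _; exact: interior_subset.
Qed.

End Paths.

Lemma dchoice (I : Type) (T : I -> Type) (P : forall i, T i -> Prop) :
  (forall i, exists x, P i x) -> exists f : forall i, T i, forall i, P i (f i).
Proof.
by move=> H; exists (fun i => sval (cid (H i))) => i; exact: svalP.
Qed.

(** * Paths, loops and torsion in product spaces *)

Section Products.
Context {I : eqType} (K : I -> topologicalType).
Local Notation X := (prod_topology K).

Lemma prod_continuous (T : topologicalType) (f : T -> X) :
  (forall i, continuous (fun t => f t i)) -> continuous f.
Proof.
move=> cf t; apply/cvg_sup => i U [_ [[W oW <-] Wf WU]].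
apply: (filterS WU); apply: (cf i t); exact: open_nbhs_nbhs.
Qed.

Lemma prod_coord_continuous i : continuous (fun x : X => x i).
Proof. exact: proj_continuous. Qed.

Lemma prod_nbhsP (x : X) (U : set X) : nbhs x U ->
  exists (s : seq I) (W : forall i, set (K i)),
  (forall i, nbhs (x i) (W i)) /\ forall y : X, (forall i, i \in s -> W i (y i)) -> U y.
Proof.
pose F : set_system X := [set U | exists (s : seq I) (W : forall i, set (K i)),
  (forall i, nbhs (x i) (W i)) /\ forall y : X, (forall i, i \in s -> W i (y i)) -> U y].
have FF : Filter F.
  split.
  - by exists [::], (fun=> setT); split => // i; exact: filterT.
  - move=> A B [s [W [xW WA]]] [s' [W' [xW' WB]]].
    exists (s ++ s'), (fun i => W i `&` W' i); split => [i|y Wy].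
      exact: filterI.
    split; [apply: WA|apply: WB] => i si;
      by have [] := Wy i; rewrite ?mem_cat ?si ?orbT.
  - by move=> A B AB [s [W [xW WA]]]; exists s, W; split => // y /WA/AB.
suff : F --> x by exact.
apply/cvg_sup => i A [_ [[W oW <-] Wx WA]].
apply: (@filterS _ F _ _ _ WA).
(* The factor is [W] at [j = i], transported along the equality, and the whole space elsewhere,
   where the condition is vacuous. *)
exists [:: i], (fun j => [set z | forall e : j = i, W (ecast k (K k) e z)]).
split=> [j|y]; last by move=> /(_ i); rewrite mem_head => /(_ isT)/(_ erefl).
have [ji|ji] := eqVneq j i; last by apply: nearW => z e; rewrite e eqxx in ji.
move: ji => {j} ->; have : nbhs (x i) W by exact: open_nbhs_nbhs.
by apply: filterS => z Wz e; rewrite (eq_axiomK e).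
Qed.

Lemma prod_path_connected (R : realType) :
  (forall i, path_connected R (K i)) -> path_connected R X.
Proof.
move=> pK x y; have [g gP] := dchoice (fun i => pK i (x i) (y i)).
exists (fun t i => g i t); split.
- by apply: prod_continuous => i; have [] := gP i.
- by apply: functional_extensionality_dep => i; have [] := gP i.
- by apply: functional_extensionality_dep => i; have [] := gP i.
Qed.

(** Short paths are used in the finitely many constrained coordinates, arbitrary paths in all
    others. *)
Lemma prod_locally_path_joined (R : realType) :
  (forall i, path_connected R (K i)) ->
  (forall i, locally_path_joined R (K i)) -> locally_path_joined R X.
Proof.
move=> pK lK x U /prod_nbhsP[s [W [xW WU]]].
have : \forall y \near x, forall i, i \in s ->
    exists g : R -> K i, [/\ continuous g, g 0 = x i, g 1 = y i & forall t, W i (g t)].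
  elim: s {WU} => [|i s IH]; first by near=> y => i; rewrite in_nil.
  have Wi : \forall y \near x, exists g : R -> K i,
      [/\ continuous g, g 0 = x i, g 1 = y i & forall t, W i (g t)].
    exact: prod_coord_continuous (lK i (x i) _ (xW i)).
  apply: filterS2 IH Wi => y ys yi j.
  rewrite inE; have [-> _|] := eqVneq j i; first exact: yi.
  by move=> _; exact: ys.
apply: filterS => y ys.
pose P i (g : R -> K i) :=
  [/\ continuous g, g 0 = x i, g 1 = y i & i \in s -> forall t, W i (g t)].
have /dchoice[g gP] : forall i, exists g, P i g.
  move=> i; have [/ys[g [cg g0 g1 gW]]|is_] := boolP (i \in s).
    by exists g.
  by have [g [cg g0 g1]] := pK i (x i) (y i); exists g; split => //; rewrite (negbTE is_).
exists (fun t i => g i t); split.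
- by apply: prod_continuous => i; have [] := gP i.
- by apply: functional_extensionality_dep => i; have [] := gP i.
- by apply: functional_extensionality_dep => i; have [] := gP i.
- by move=> t; apply: WU => i si; have [_ _ _] := gP i; exact.
Unshelve. all: by end_near. Qed.

Lemma prod_compact : (forall i, compact [set: K i]) -> compact [set: X].
Proof.
move=> cK; have -> : [set: X] = [set f | forall i, [set: K i] (f i)].
  by apply/seteqP; split.
exact: (@tychonoff _ K (fun=> setT)).
Qed.

Lemma prod_null_loop (R : realType) (f : R -> X) :
  (forall i, null_loop (fun t => f t i)) -> null_loop f.
Proof.
move=> /dchoice[F /dchoice[c Fc]].
exists (fun u i => F i u), c; split => [|x x01|x x01|s s01];
  do ?[apply: prod_continuous => i | apply: functional_extensionality_dep => i];
  have [cF F0 F1 Fs] := Fc i => //.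
- exact: F0.
- exact: F1.
- exact: Fs.
Qed.

(** Homotopies assemble coordinatewise, so an essential loop has an essential coordinate, whose
    [n]-th power is null by projection. *)
Lemma prod_no_torsion (R : realType) (n : nat) :
  (forall i, ~ has_torsion R (K i) n) -> ~ has_torsion R X n.
Proof.
move=> nK [f [cf fp fnull fnnull]]; apply: fnull; apply: prod_null_loop => i.
apply: contrapT => fi; apply: (nK i); exists (fun t => f t i); split => //.
- exact: comp_continuous cf (@prod_coord_continuous i).
- by move=> x; rewrite fp.
- exact: (null_loop_comp (@prod_coord_continuous i) fnnull).
Qed.

(** The factor [K i] is a retract: it embeds as the slice through [x], and the projection undoes the
    embedding. *)
Lemma prod_torsion (R : realType) (n : nat) (x : X) i :
  has_torsion R (K i) n -> has_torsion R X n.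
Proof.
move=> [f [cf fp fnull fnnull]].
have cd : continuous (dfwith x i : K i -> X) by exact: dfwith_continuous.
exists (fun t => dfwith x i (f t)); split.
- exact: comp_continuous cf cd.
- by move=> t; rewrite fp.
- move=> /(null_loop_comp (@prod_coord_continuous i)) h; apply: fnull.
  have <- // : (fun y : X => y i) \o (fun t => dfwith x i (f t)) = f.
  by apply/funext => t /=; rewrite dfwithin.
- exact: (null_loop_comp cd fnnull).
Qed.

End Products.

Lemma homeomorphic_torsion (R : realType) (X Y : topologicalType) (n : nat) :
  homeomorphic X Y -> has_torsion R X n -> has_torsion R Y n.
Proof.
move=> [h [k [ch ck hk kh]]] [f [cf fp fnull fnnull]]; exists (h \o f); split.
- exact: comp_continuous cf ch.
- by move=> x /=; rewrite fp.
- move=> /(null_loop_comp ck) H; apply: fnull.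
  have <- // : k \o (h \o f) = f by apply/funext => t /=; rewrite hk.
- exact: (null_loop_comp ch fnnull).
Qed.

(** * A metric on countable products *)

Section ProductMetric.
Context {R : realType} (K : nat * nat -> metricType R).

(** A separate name for the points of the product, to carry the metric topology beside the product
    topology. *)
Definition metric_prod := forall i, K i.

HB.instance Definition _ := gen_eqMixin metric_prod.
HB.instance Definition _ := gen_choiceMixin metric_prod.

Let w (i : nat * nat) : R := (pickle i).+1%:R^-1.

Let w_gt0 i : 0 < w i. Proof. by rewrite invr_gt0 ltr0n. Qed.

Let dists (x y : metric_prod) : set R :=
  [set Num.min (w i) (mdist (x i) (y i)) | i in [set: nat * nat]].

Definition prod_dist (x y : metric_prod) : R := sup (dists x y).

Let dists0 x y : dists x y !=set0.
Proof. by eexists; exists (0, 0)%N. Qed.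

Lemma prod_dist_le x y (c : R) :
  (forall i, Num.min (w i) (mdist (x i) (y i)) <= c) -> prod_dist x y <= c.
Proof. by move=> xy; apply: ge_sup (dists0 x y) _ => _ [i _ <-]. Qed.

Lemma prod_dist_ge x y i : Num.min (w i) (mdist (x i) (y i)) <= prod_dist x y.
Proof.
apply: ub_le_sup; last by exists i.
exists 1 => _ [j _ <-]; rewrite ge_min invf_le1 ?ltr0n// ler1n orbC.
by rewrite orbT.
Qed.

Let prod_distxx x : prod_dist x x = 0.
Proof.
apply/eqP; rewrite eq_le; apply/andP; split.
  by apply: prod_dist_le => i; rewrite mdistxx ge_min lexx orbT.
by rewrite (le_trans _ (prod_dist_ge x x (0, 0)%N))// le_min mdist_ge0 ltW.
Qed.

Let prod_dist_positivity x y : prod_dist x y = 0 -> x = y.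
Proof.
move=> xy; apply: functional_extensionality_dep => i.
apply: mdist_positivity; apply/eqP; rewrite eq_le mdist_ge0 andbT.
by have := prod_dist_ge x y i; rewrite xy ge_min leNgt w_gt0.
Qed.

Let prod_dist_sym x y : prod_dist x y = prod_dist y x.
Proof.
by congr sup; apply/seteqP; split=> _ [i _ <-]; exists i; rewrite // metric_sym.
Qed.

Let prod_dist_triangle y x z : prod_dist x z <= prod_dist x y + prod_dist y z.
Proof.
apply: prod_dist_le => i.
apply: (@le_trans _ _ (Num.min (w i) (mdist (x i) (y i)) +
    Num.min (w i) (mdist (y i) (z i)))); last by rewrite lerD ?prod_dist_ge.
have := metric_triangle (x i) (y i) (z i).
have := mdist_ge0 (x i) (y i); have := mdist_ge0 (y i) (z i); have := w_gt0 i.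
rewrite /Num.min; do 3 case: ifPn; rewrite -?leNgt; lra.
Qed.

HB.instance Definition _ := @isMetric.Build R metric_prod prod_dist prod_distxx
  prod_dist_positivity prod_dist_sym prod_dist_triangle.

Lemma prod_metrizable : metrizable R (prod_topology K).
Proof.
exists metric_prod, id, id; split => //.
- move=> x; have FF := @nbhs_filter (prod_topology K) x.
  apply/(@metricType_numDomainType.cvgrPdist_lt _ metric_prod _ _
    FF) => e e0.
  have [N /= Ne] := ltr_add_invr (divr_gt0 e0 (ltr0n R 2)).
  rewrite add0r in Ne.
  (* Only the finitely many indices with code at most [N] need control; all others have weight below
     [e / 2]. *)
  have xk (k : 'I_N.+1) : \forall y \near (x : prod_topology K),
      forall i, unpickle k = Some i -> mdist (x i) (y i) <= e / 2.
    case: (unpickle _) => [i|]; last by near=> y.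
    have := @prod_coord_continuous _ K i x.
    move=> /metricType_numDomainType.cvgrPdist_le/(_ _ (divr_gt0 e0 (ltr0n R 2))).
    by apply: filterS => y xy j [<-].
  have := @filter_forall _ _ _ _ FF xk.
  apply: filterS => y xy; apply: (@le_lt_trans _ _ (e / 2)); last first.
    by rewrite ltr_pdivrMr// ltr_pMr// ltr1n.
  apply: prod_dist_le => i; rewrite ge_min.
  have [iN|iN] := ltnP (pickle i) N.+1.
    by rewrite (xy (Ordinal iN)) ?orbT//= pickleK.
  by rewrite (le_trans _ (ltW Ne))// lef_pV2 ?posrE ?ltr0n// ler_nat ltnW.
- apply: prod_continuous => i x; have FF := @nbhs_filter metric_prod x.
  apply/(@metricType_numDomainType.cvgrPdist_lt _ (K i) _ _ FF) => e e0.
  have d0 : 0 < Num.min (w i) e by rewrite lt_min w_gt0 e0.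
  have /metricType_numDomainType.cvgrPdist_lt/(_ _ d0) :
    (y : metric_prod) @[y --> (x : metric_prod)] --> x by exact: cvg_id.
  apply: filterS => y /(le_lt_trans (prod_dist_ge x y i)).
  by rewrite gt_min !lt_min ltxx/= => /andP[_].
Unshelve. all: by end_near. Qed.

End ProductMetric.

(** * Global and local paths in the orbit spaces *)

Section Lens.
Context {R : realType} {q : nat} (pp : prime q.+4).
Local Notation D := (sphere_deck pp : deck 'rV[R]_q.+4).

Lemma lens_path_connected : path_connected R (orbits D).
Proof.
move=> x y; have [a Sa <-] := clsP x; have [b Sb <-] := clsP y.
have [g [cg Sg g0 g1]] := sphere_path Sa Sb.
exists (cls D \o g); split; first exact: cls_continuous.
- by rewrite /= g0.
- by rewrite /= g1.
Qed.

Lemma lens_locally_path_joined : locally_path_joined R (orbits D).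
Proof.
move=> x U /nbhs_ballP[e /= e0 xU]; have [a Sa ax] := clsP x.
have [d d0 short] := @sphere_short_path R q e e0.
apply/nbhs_ballP; exists d => //= y; rewrite ballEmdist /= -{1}ax => xy.
have [b [Sb by_ ab]] := mdist_lift y Sa.
have [|g [cg Sg g0 g1 ge]] := short a b Sa Sb; first by rewrite ab.
exists (cls D \o g); split => [||| t]; first exact: cls_continuous.
- by rewrite /= g0.
- by rewrite /= g1.
- apply: xU; rewrite ballEmdist /= -ax (le_lt_trans (mdist_cls_le (D := D) Sa (Sg t)))//.
Qed.

End Lens.

(** * The family *)

Fixpoint prime_seq (n : nat) : nat :=
  if n is n'.+1 then s2val (prime_above (prime_seq n')) else 5.

Lemma prime_seq_prime n : prime (prime_seq n).
Proof. by case: n => //= n; case: prime_above. Qed.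

Lemma prime_seq_ltn : {homo prime_seq : m n / (m < n)%N}.
Proof.
by apply: homo_ltn; [exact: ltn_trans|move=> n /=; case: prime_above].
Qed.

Lemma prime_seq_inj : injective prime_seq.
Proof. exact: (inc_inj (leq_mono prime_seq_ltn)). Qed.

Lemma prime_seq_ge4 n : (4 <= prime_seq n)%N.
Proof.
case: n => // n; apply: leq_trans (ltnW (prime_seq_ltn (ltn0Sn n))).
by [].
Qed.

(** The spheres are set in dimension [q.+4], hence the offset 4. *)
Definition lens_dim (n : nat) : nat := prime_seq n - 4.

Lemma lens_dimE n : (lens_dim n).+4 = prime_seq n.
Proof. by rewrite -addn4 subnK// prime_seq_ge4. Qed.

Lemma lens_dim_prime n : prime (lens_dim n).+4.
Proof. by rewrite lens_dimE prime_seq_prime. Qed.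

Lemma lens_dim_coprime m n : m <> n ->
  coprime (lens_dim m).+4 (lens_dim n).+4.
Proof.
move=> mn; rewrite !lens_dimE prime_coprime ?prime_seq_prime//.
rewrite dvdn_prime2 ?prime_seq_prime//.
by apply/eqP => /prime_seq_inj.
Qed.

Section Family.
Context {R : realType}.

Definition code (r : R) (n : nat) : nat := pickle (n, Num.floor (n%:R * r)).

(** Choose [n] with [1/n < |r - s|]: then [n r] and [n s] are more than 1 apart and have different
    floors. The first component of the code excludes every [m] other than [n]. *)
Lemma code_sep (r s : R) : r <> s -> exists n, forall m, code r n <> code s m.
Proof.
move=> /eqP; rewrite -subr_eq0 -normr_gt0 => /ltr_add_invr[k].
rewrite add0r -(@ltr_pM2l _ k.+1%:R) ?ltr0n// divff ?pnatr_eq0// => rs.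
exists k.+1 => m /(pcan_inj pickleK)[<- fl].
have floorB (z : R) : exists2 d, 0 <= d < 1 & z = (Num.floor z)%:~R + d.
  exists (z - (Num.floor z)%:~R); last by rewrite addrC subrK.
  by have := floor_itv z; rewrite rmorphD rmorph1 subr_ge0 ltrBlDl.
have [d /andP[d0 d1] rE] := floorB (k.+1%:R * r).
have [e /andP[e0 e1] sE] := floorB (k.+1%:R * s).
move: rs; rewrite -[X in X * _]ger0_norm ?ler0n// -normrM mulrBr rE sE fl.
rewrite addrAC opprD addrA subrr add0r addrC lter_normr => /orP[]; lra.
Qed.

Definition lens (n : nat) : metricType R :=
  orbits (sphere_deck (lens_dim_prime n) : deck 'rV[R]_(lens_dim n).+4).

(** The second index is a multiplicity: every factor occurs infinitely often. *)
Definition lens_factor (r : R) (ij : nat * nat) : metricType R :=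
  lens (code r ij.1).

Definition lens_product (r : R) : topologicalType := prod_topology (lens_factor r).

Lemma lens_product_peano r : peano_continuum R (lens_product r).
Proof.
have pc : path_connected R (lens_product r).
  by apply: prod_path_connected => i; exact: lens_path_connected.
have ne : [set: lens_product r] !=set0.
  by exists (fun i => orbits_base _).
split; first split => //.
- by apply: prod_compact => i; exact: orbits_compact.
- exact: path_connected_connected pc.
- exact: prod_metrizable.
- apply: (@locally_path_joined_connected R); apply: prod_locally_path_joined => i.
  + exact: lens_path_connected.
  + exact: lens_locally_path_joined.
Qed.

Lemma lens_product_torsion r n : has_torsion R (lens_product r) (lens_dim (code r n)).+4.
Proof.
apply: (@prod_torsion _ _ _ _ (fun i => orbits_base _) (n, 0%N)).
exact: sphere_torsion.
Qed.

Lemma lens_product_no_torsion r n : (forall m, n <> code r m) ->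
  ~ has_torsion R (lens_product r) (lens_dim n).+4.
Proof.
move=> nr; apply: prod_no_torsion => i; apply: no_torsion => //.
  exact: sphere_loops_null.
exact: lens_dim_coprime.
Qed.

(** The even copies of each factor hold one point of the pair, the odd copies the other. *)
Lemma lens_product_square r :
  homeomorphic (lens_product r * lens_product r)%type (lens_product r).
Proof.
pose join (u : lens_product r * lens_product r) : lens_product r := fun i =>
  if odd i.2 then u.2 (i.1, i.2./2) else u.1 (i.1, i.2./2).
pose split (z : lens_product r) : lens_product r * lens_product r :=
  (fun i => z (i.1, i.2.*2), fun i => z (i.1, i.2.*2.+1)).
exists join, split; split.
- apply: prod_continuous => -[n j]; rewrite /join /=.
  case: (odd j).
    exact: (comp_continuous (@snd_continuous _ _)
      (@prod_coord_continuous _ (lens_factor r) (n, j./2))).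
  exact: (comp_continuous (@fst_continuous _ _)
      (@prod_coord_continuous _ (lens_factor r) (n, j./2))).
- apply: pair_continuous; apply: prod_continuous => -[n j] /=.
  + exact: (@prod_coord_continuous _ (lens_factor r) (n, j.*2)).
  + exact: (@prod_coord_continuous _ (lens_factor r) (n, j.*2.+1)).
- move=> [x y]; congr (_, _); apply: functional_extensionality_dep => -[n j];
    rewrite /join /= odd_double /=.
  + have : j.*2./2 = j by rewrite doubleK.
    by move=> ->.
  + have : uphalf j.*2 = j by rewrite uphalf_double.
    by move=> ->.
- move=> z; apply: functional_extensionality_dep => -[n j]; rewrite /join /=.
  (* With [n] fixed the factors no longer depend on [j], so the index can be rewritten inside
     [g]. *)
  pose g j : lens (code r n) := z (n, j).
  rewrite -[LHS]/(if odd j then g (j./2).*2.+1 else g (j./2).*2) -/(g j).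
  by case: ifP => oj; congr g; rewrite -[RHS]odd_double_half oj.
Qed.

End Family.

Theorem theorem3p5 (R : realType) :
  exists P : R -> topologicalType,
    [/\ forall r : R, peano_continuum R (P r),
        forall r s : R, r <> s -> ~ homeomorphic (P r) (P s) &
        forall r : R, homeomorphic (P r * P r)%type (P r)].
Proof.
exists lens_product; split; [exact: lens_product_peano| |exact: lens_product_square].
move=> r s /code_sep[n rs] /homeomorphic_torsion/(_ (lens_product_torsion r n)).
exact: lens_product_no_torsion.
Qed.
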